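(* Let $\mathscr{A}=(G,\partial)$ be a unicyclization of a connected graph $G$, let $\beta$ be a basis of $Z_1(G)=\ker\partial_1$, and let $\sigma$ be an edge of $G$ that is not a loop. Let $G_c=G/\sigma$. Then there are a unicyclization $\mathscr{A}_c=(G_c,\partial_c)$ of $G_c$ and a basis $\beta_c$ of $Z_1(G_c)$ such that for every $C\in\ker\partial_1$, $$[C]_\beta=[C_c]_{\beta_c}\quad\text{and}\quad w_{\mathscr{A}}(C)=w_{\mathscr{A}_c}(C_c),$$ where $C_c\in\mathbb{Z}^{E(G_c)}$ is the vector obtained from $C$ by deleting the entry at $\sigma$.
   Context: Graphs are finite and connected; loops and multiple edges are allowed. Fix an orientation of each edge. $\partial_1:\mathbb{Z}^{E(G)}\to\mathbb{Z}^{V(G)}$ is the (oriented) incidence matrix (a loop gives a zero column). $Z_1(G)=\ker\partial_1$ is a free abelian group of rank $m=|E(G)|-|V(G)|+1$; bases are ordered $\mathbb{Z}$-bases. $G/\sigma$ is obtained by removing the non-loop edge $\sigma$ and identifying its two end vertices (so $E(G/\sigma)=E(G)\setminus\{\sigma\}$, with inherited orientations). A unicyclizer of $G$ is an integer matrix $\partial$ (rows indexed by $E(G)$) with (1) $\ker\partial=0$, (2) $\partial_1\partial=0$, (3) $\operatorname{rk}(\ker\partial_1/\operatorname{im}\partial)=1$. So $\partial$ has $m-1$ linearly independent columns, all in $Z_1(G)$. The pair $\mathscr{A}=(G,\partial)$ is called a unicyclization of $G$. For a basis $\beta$ of $Z_1(G)$, $[z]_\beta\in\mathbb{Z}^m$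 is the coordinate column vector of $z\in Z_1(G)$, and $[\partial]_\beta$ is the $m\times(m-1)$ matrix whose columns are the coordinate vectors of the columns of $\partial$. The winding number map of $\mathscr{A}$ relative to $\beta$ is $w_{\mathscr{A}}(z)=\det([z]_\beta,[\partial]_\beta)$ (first column $[z]_\beta$); $w_{\mathscr{A}_c}$ is taken relative to $\beta_c$. *)

(* Defs.v *)
From HB Require Import structures.
From mathcomp Require Import all_boot all_order all_algebra.

Set Implicit Arguments.
Unset Strict Implicit.
Unset Printing Implicit Defensive.

Import GRing.Theory.
Local Open Scope ring_scope.

Definition lincomb (V : zmodType) n (v : 'I_n -> V) (x : 'cV[int]_n) : V :=
  \sum_i v i *~ x i 0.

Record zbasis (V : zmodType) n := ZBasis {
  bvec :> 'I_n -> V;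
  zbasis_span : forall z : V, exists x : 'cV[int]_n, z == lincomb bvec x;
  zbasis_free : forall x : 'cV[int]_n, lincomb bvec x = 0 -> x = 0
}.

(* By freeness, [zcoord b z] is the only column x with [z = lincomb b x]. *)
Definition zcoord (V : zmodType) n (b : zbasis V n) (z : V) : 'cV[int]_n :=
  xchoose (zbasis_span b z).

(* [quotient_rank A B r] : the abelian group A / B (for subgroups B of A of V)
   has rank r, i.e. r is the largest size of a family of elements of A whose
   classes modulo B are linearly independent over the integers. *)
Definition independent_mod (V : zmodType) (B : V -> Prop) n (v : 'I_n -> V) :=
  forall x : 'cV[int]_n, B (lincomb v x) -> x = 0.

Definition quotient_rank (V : zmodType) (A B : V -> Prop) (r : nat) : Prop :=
  (exists v : 'I_r -> V, (forall i, A (v i)) /\ independent_mod B v) /\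
  (forall (s : nat) (v : 'I_s -> V),
     (forall i, A (v i)) -> independent_mod B v -> (s <= r)%N).

Definition adjacent (V E : finType) (src tgt : E -> V) : rel V :=
  fun u v => [exists e, ((src e == u) && (tgt e == v))
                     || ((src e == v) && (tgt e == u))].

Definition connected_graph (V E : finType) (src tgt : E -> V) : Prop :=
  (0 < #|V|)%N /\ forall u v : V, connect (adjacent src tgt) u v.

Record graph := Graph {
  vertex : finType;
  edge : finType;
  src : edge -> vertex;
  tgt : edge -> vertex;
  graph_connected : connected_graph src tgt
}.

Arguments src {g} _.
Arguments tgt {g} _.

Notation chain0 G := {ffun vertex G -> int}.
Notation chain1 G := {ffun edge G -> int}.

Definition incidence (G : graph) (v : vertex G) (e : edge G) : int :=
  (tgt e == v)%:R - (src e == v)%:R.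

Definition boundary (G : graph) (z : chain1 G) : chain0 G :=
  [ffun v => \sum_e incidence v e * z e].

Definition ker_boundary (G : graph) : {pred chain1 G} :=
  [pred z | boundary z == 0].

Lemma ker_boundary_zmod_closed G : zmod_closed (@ker_boundary G).
Proof.
split=> [|x y]; rewrite !inE.
  apply/eqP/ffunP => v; rewrite !ffunE; apply: big1 => e _.
  by rewrite ffunE mulr0.
move=> /eqP/ffunP x0 /eqP/ffunP y0; apply/eqP/ffunP => v.
move: (x0 v) (y0 v); rewrite !ffunE => xv yv.
under eq_bigr => e _ do rewrite !ffunE mulrBr.
by rewrite sumrB xv yv subr0.
Qed.

HB.instance Definition _ G :=
  GRing.isZmodClosed.Build (chain1 G) (@ker_boundary G)
    (@ker_boundary_zmod_closed G).

Record Z1 (G : graph) := MkZ1 {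
  chain_of_Z1 :> chain1 G;
  Z1P : chain_of_Z1 \in @ker_boundary G
}.

HB.instance Definition _ G := [isSub for @chain_of_Z1 G].
HB.instance Definition _ G := [Choice of Z1 G by <:].
HB.instance Definition _ G := [SubChoice_isSubZmodule of Z1 G by <:].

(* The matrix is given by its k columns; [lincomb bd x] is then its product
   with the column vector x. The three conditions force the rank of [Z1 G] to
   be k + 1, so that every basis of [Z1 G] has k.+1 elements. *)
Record unicyclization (G : graph) (k : nat) := Unicyclization {
  ucol :> 'I_k -> chain1 G;
  ucol_inj : forall x : 'cV[int]_k, lincomb ucol x = 0 -> x = 0;
  ucol_ker : forall j, ucol j \in @ker_boundary G;
  ucol_rank : quotient_rank (fun z => z \in @ker_boundary G)
                (fun z => exists x : 'cV[int]_k, z = lincomb ucol x) 1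
}.

Definition ucycle (G : graph) k (A : unicyclization G k) (j : 'I_k) : Z1 G :=
  MkZ1 (ucol_ker A j).

Definition ucoord (G : graph) k n (A : unicyclization G k)
    (b : zbasis (Z1 G) n) : 'M[int]_(n, k) :=
  \matrix_(i, j) zcoord b (ucycle A j) i 0.

Definition winding (G : graph) k (A : unicyclization G k)
    (b : zbasis (Z1 G) k.+1) (z : Z1 G) : int :=
  \det (row_mx (zcoord b z) (ucoord A b) : 'M[int]_(1 + k)).

Section Contraction.

Variables (G : graph) (s : edge G) (hs : src s != tgt s).

(* The vertex obtained by identifying the two ends of s is represented by
   [src s]: the vertices of the contraction are those of G except [tgt s]. *)
Definition cvertex : finType := {v : vertex G | v != tgt s}.
Definition cedge : finType := {e : edge G | e != s}.

Definition cmerge (v : vertex G) : cvertex :=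
  insubd (Sub (src s) hs : cvertex) v.

Definition csrc (e : cedge) : cvertex := cmerge (src (val e)).
Definition ctgt (e : cedge) : cvertex := cmerge (tgt (val e)).

Lemma cmerge_val (v : cvertex) : cmerge (val v) = v.
Proof. exact: valKd. Qed.

Lemma cmerge_ends : cmerge (src s) = cmerge (tgt s).
Proof.
apply: val_inj; rewrite !val_insubd hs; case: ifP => //=.
by rewrite eqxx.
Qed.

Lemma contract_connected : connected_graph csrc ctgt.
Proof.
split; first by apply/card_gt0P; exists (cmerge (src s)).
move=> u v; rewrite -(cmerge_val u) -(cmerge_val v).
have /connectP [p] := (graph_connected G).2 (val u) (val v).
elim: p (val u) => [|w p IH] x /=; first by move=> _ ->; apply: connect0.
case/andP=> /existsP [e he] hp hv.
apply: connect_trans (IH w hp hv).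
have [es|es] := eqVneq e s.
  by case/orP: he => /andP [/eqP <- /eqP <-]; rewrite es cmerge_ends connect0.
apply: connect1; apply/existsP; exists (Sub e es : cedge).
by case/orP: he => /andP [/eqP <- /eqP <-]; rewrite /csrc /ctgt /= !eqxx ?orbT.
Qed.

Definition contract : graph := Graph contract_connected.

Definition delete_entry (z : chain1 G) : chain1 contract :=
  [ffun e : cedge => z (val e)].

End Contraction.

(* Main.v *)
(* Deleting the entry at sigma is an isomorphism from Z_1(G) onto Z_1(G/sigma):
   the boundary of the shortened chain at a vertex of G/sigma is the sum of the
   boundaries over the vertices merged into it, and the deleted entry is
   recovered from the condition that the boundary vanishes at the end of sigma.
   Transporting the columns of the unicyclizer and the basis along this
   isomorphism leaves all coordinates unchanged, hence also the determinant. *)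

Require Import Defs.
From HB Require Import structures.
From mathcomp Require Import all_boot all_order all_algebra.

Set Implicit Arguments.
Unset Strict Implicit.
Unset Printing Implicit Defensive.

Import GRing.Theory.
Local Open Scope ring_scope.

Lemma lincombB (V : zmodType) n (v : 'I_n -> V) (x y : 'cV[int]_n) :
  lincomb v (x - y) = lincomb v x - lincomb v y.
Proof. by rewrite -sumrB; apply: eq_bigr => i _; rewrite !mxE mulrzBr. Qed.

Lemma raddf_lincomb (V W : zmodType) (f : {additive V -> W}) n
    (v : 'I_n -> V) (x : 'cV[int]_n) :
  f (lincomb v x) = lincomb (f \o v) x.
Proof. by rewrite raddf_sum; apply: eq_bigr => i _; rewrite raddfMz. Qed.

Lemma eq_lincomb (V : zmodType) n (v w : 'I_n -> V) :
  v =1 w -> lincomb v =1 lincomb w.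
Proof. by move=> vw x; apply: eq_bigr => i _; rewrite vw. Qed.

Lemma rpred_lincomb (V : zmodType) (S : zmodClosed V) n (v : 'I_n -> V) x :
  (forall i, v i \in S) -> lincomb v x \in S.
Proof. by move=> Sv; apply: rpred_sum => i _; apply: rpredMz. Qed.

Lemma zcoordK (V : zmodType) n (b : zbasis V n) z : lincomb b (zcoord b z) = z.
Proof. by rewrite -(eqP (xchooseP (zbasis_span b z))). Qed.

Lemma zcoord_lincomb (V : zmodType) n (b : zbasis V n) x :
  zcoord b (lincomb b x) = x.
Proof.
apply/subr0_eq/(@zbasis_free _ _ b).
by rewrite lincombB zcoordK subrr.
Qed.

Section BasisTransport.

Variables (V W : zmodType) (f : {additive V -> W}) (g : W -> V).
Hypotheses (fK : cancel f g) (gK : cancel g f).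
Variables (n : nat) (b : zbasis V n).

Lemma map_zbasis_span z : exists x : 'cV[int]_n, z == lincomb (f \o b) x.
Proof. by exists (zcoord b (g z)); rewrite -raddf_lincomb zcoordK gK. Qed.

Lemma map_zbasis_free x : lincomb (f \o b) x = 0 -> x = 0.
Proof.
rewrite -raddf_lincomb -(raddf0 f) => /(can_inj fK).
exact: zbasis_free.
Qed.

Definition map_zbasis : zbasis W n := ZBasis map_zbasis_span map_zbasis_free.

(** [zcoord] is obtained by choice, so the equality rests on uniqueness: additivity of [f] writes
    [f z] as the combination of the image basis with the coefficients of [z]. *)
Lemma zcoord_map_zbasis z : zcoord map_zbasis (f z) = zcoord b z.
Proof.
by rewrite -{1}(zcoordK b z) raddf_lincomb (zcoord_lincomb map_zbasis).
Qed.

End BasisTransport.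

(** Independent families are pushed along [f] and pulled back along [g]. The inverse laws are
    confined to the subgroups because the ranks are stated inside the ambient groups of chains. *)
Lemma quotient_rank_iso (V W : zmodType) (f : {additive V -> W}) (g : W -> V)
    (S : zmodClosed V) (A' B' : W -> Prop) (B : V -> Prop) r :
    (forall z, z \in S -> A' (f z)) ->
    (forall z, A' z -> g z \in S) ->
    (forall z, A' z -> f (g z) = z) ->
    (forall z, z \in S -> B z <-> B' (f z)) ->
  quotient_rank (fun z => z \in S) B r -> quotient_rank A' B' r.
Proof.
move=> fA gA gK fB [[v [Sv indep_v]] max_r]; split.
  exists (f \o v); split=> [i|x]; first exact/fA.
  rewrite -raddf_lincomb => B'x; apply: indep_v.
  by apply/fB => //; apply: rpred_lincomb.
move=> s w Aw indep_w; apply: (max_r s (g \o w)) => [i|x Bx]; first exact: gA.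
(* Written as [f \o (g \o w)], the family has combinations that are images under [f], to which [fB]
   applies. *)
apply: indep_w; rewrite (@eq_lincomb _ _ w (f \o (g \o w))).
  rewrite -raddf_lincomb; apply/fB => //.
  by apply: rpred_lincomb => i; apply: gA.
by move=> i; rewrite /= gK.
Qed.

Section ContractedCycles.

Variables (G : graph) (s : edge G) (hs : src s != tgt s).

Local Notation Gc := (contract hs).
Local Notation del := (delete_entry hs).

Lemma delete_entry_is_zmod_morphism : zmod_morphism del.
Proof. by move=> y z; apply/ffunP => e; rewrite !ffunE. Qed.

HB.instance Definition _ :=
  GRing.isZmodMorphism.Build _ _ del delete_entry_is_zmod_morphism.

Lemma sum_cmerge_incidence (w : vertex Gc) (e : edge G) :
  \sum_(v | cmerge hs v == w) incidence v e =
    (cmerge hs (tgt e) == w)%:R - (cmerge hs (src e) == w)%:R.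
Proof.
have sum_delta u :
    \sum_(v | cmerge hs v == w) (u == v)%:R = (cmerge hs u == w)%:R :> int.
  rewrite big_mkcond (bigD1 u) //= eqxx big1 ?addr0; first by case: ifP.
  by move=> v /negPf; rewrite eq_sym => ->; rewrite if_same.
by rewrite sumrB !sum_delta.
Qed.

Lemma boundary_delete_entry (z : chain1 G) (w : vertex Gc) :
  boundary (del z) w = \sum_(v | cmerge hs v == w) boundary z v.
Proof.
under [RHS]eq_bigr => v _ do rewrite ffunE.
rewrite exchange_big ffunE /= (bigD1 s) //=.
(* The edge [s] contributes nothing, as its two ends merge. *)
rewrite -mulr_suml sum_cmerge_incidence cmerge_ends subrr mul0r add0r.
rewrite (reindex_omap (op := +%R) (val : cedge s -> edge G) insub) /=; last first.
  by move=> e es; rewrite insubT.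
apply: eq_big => [e|e _]; first by rewrite (valP e) valK eqxx.
by rewrite -mulr_suml sum_cmerge_incidence ffunE.
Qed.

(** Besides [val w], the fibre over [w] contains at most [tgt s], where the boundary vanishes. *)
Lemma boundary_delete_entry_val (z : chain1 G) (w : vertex Gc) :
  boundary z (tgt s) = 0 -> boundary (del z) w = boundary z (val w).
Proof.
move=> zt; rewrite boundary_delete_entry (bigD1 (val w)) ?cmerge_val //=.
rewrite big1 ?addr0 // => v /andP[/eqP <-].
have [->//|vt] := eqVneq v (tgt s).
by rewrite val_insubd vt eqxx.
Qed.

Lemma ker_boundary_delete_entry (z : chain1 G) : boundary z (tgt s) = 0 ->
  (del z \in @ker_boundary Gc) = (z \in @ker_boundary G).
Proof.
move=> zt; rewrite !inE; apply/eqP/eqP => /ffunP z0; apply/ffunP => v.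
  have [->|vt] := eqVneq v (tgt s); first by rewrite zt ffunE.
  have := z0 (Sub v vt : cvertex s).
  by rewrite boundary_delete_entry_val // !ffunE.
by rewrite boundary_delete_entry_val // z0 !ffunE.
Qed.

Lemma ker_boundaryE (z : chain1 G) v : z \in @ker_boundary G -> boundary z v = 0.
Proof. by rewrite inE => /eqP->; rewrite ffunE. Qed.

Lemma delete_entry_ker (z : chain1 G) :
  z \in @ker_boundary G -> del z \in @ker_boundary Gc.
Proof. by move=> zK; rewrite ker_boundary_delete_entry // ker_boundaryE. Qed.

(** Since [s] is not a loop, its coefficient at [tgt s] is 1; hence the other entries of a cycle
    determine the one at [s]. *)
Lemma boundary_tgt (z : chain1 G) :
  boundary z (tgt s) = z s + \sum_(e | e != s) incidence (tgt s) e * z e.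
Proof.
by rewrite ffunE (bigD1 s) //= /incidence eqxx (negPf hs) subr0 mul1r.
Qed.

(** The restriction to cycles is essential: the unit chain at [s] is sent to 0. *)
Lemma delete_entry_inj :
  {in @ker_boundary G &, injective del}.
Proof.
move=> y z yK zK /ffunP yz.
have eq_off e : e != s -> y e = z e.
  by move=> es; have := yz (Sub e es : cedge s); rewrite !ffunE.
apply/ffunP => e; have [->|/eq_off//] := eqVneq e s.
have: boundary y (tgt s) = boundary z (tgt s) by rewrite !ker_boundaryE.
rewrite !boundary_tgt.
under eq_bigr => e' es do rewrite eq_off //.
exact: addIr.
Qed.

(* The entry at s is the one making the boundary vanish at [tgt s]. *)
Definition lift_chain (z : chain1 Gc) : chain1 G :=
  [ffun e => if insub e is Some e' then z e' else
     - \sum_(e' : cedge s) incidence (tgt s) (val e') * z e'].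

Lemma lift_chainK : cancel lift_chain del.
Proof. by move=> z; apply/ffunP => e; rewrite !ffunE valK. Qed.

Lemma lift_chain_ker (z : chain1 Gc) :
  z \in @ker_boundary Gc -> lift_chain z \in @ker_boundary G.
Proof.
(* With [z] written as [del (lift_chain z)], the implication becomes trivial; what remains is the
   side condition at [tgt s]. *)
rewrite -{1}(lift_chainK z) ker_boundary_delete_entry // boundary_tgt.
rewrite ffunE insubF ?eqxx //.
rewrite (reindex_omap (op := +%R) (val : cedge s -> edge G) insub) /=; last first.
  by move=> e es; rewrite insubT.
apply/eqP; rewrite addrC subr_eq0; apply/eqP.
apply: eq_big => [e|e _]; first by rewrite (valP e) valK eqxx.
by rewrite ffunE valK.
Qed.

Definition contract_cycle (C : Z1 G) : Z1 Gc :=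
  MkZ1 (delete_entry_ker (Z1P C)).

Definition lift_cycle (C : Z1 Gc) : Z1 G := MkZ1 (lift_chain_ker (Z1P C)).

Lemma contract_cycle_is_zmod_morphism : zmod_morphism contract_cycle.
Proof. by move=> C D; apply: val_inj; rewrite /= raddfB. Qed.

HB.instance Definition _ := GRing.isZmodMorphism.Build _ _ contract_cycle
  contract_cycle_is_zmod_morphism.

Lemma lift_cycleK : cancel lift_cycle contract_cycle.
Proof. by move=> C; apply: val_inj; apply: lift_chainK. Qed.

Lemma contract_cycleK : cancel contract_cycle lift_cycle.
Proof.
move=> C; apply: val_inj; apply: delete_entry_inj; try exact: Z1P.
exact: lift_chainK.
Qed.

Section ContractUnicyclization.

Variables (k : nat) (A : unicyclization G k).

Lemma contract_ucol_inj (x : 'cV[int]_k) : lincomb (del \o A) x = 0 -> x = 0.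
Proof.
rewrite -raddf_lincomb -(raddf0 del) => /delete_entry_inj eq0.
apply: (@ucol_inj _ _ A); apply: eq0; last exact: rpred0.
by apply: rpred_lincomb; apply: ucol_ker.
Qed.

Lemma contract_ucol_rank :
  quotient_rank (fun z => z \in @ker_boundary Gc)
    (fun z => exists x : 'cV[int]_k, z = lincomb (del \o A) x) 1.
Proof.
apply: quotient_rank_iso (ucol_rank A) => [||z _|z zK].
- exact: delete_entry_ker.
- exact: lift_chain_ker.
- exact: lift_chainK.
split=> -[x zx]; exists x; first by rewrite zx raddf_lincomb.
(* Both [z] and the combination of columns are cycles, so equality after deletion lifts back to
   [G]. *)
apply: delete_entry_inj => //; last by rewrite zx -raddf_lincomb.
by apply: rpred_lincomb; apply: ucol_ker.
Qed.

Definition contract_unicyclization : unicyclization Gc k :=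
  Unicyclization contract_ucol_inj
    (fun j => delete_entry_ker (ucol_ker A j)) contract_ucol_rank.

Lemma ucycle_contract j :
  Defs.ucycle contract_unicyclization j = contract_cycle (Defs.ucycle A j).
Proof. exact: val_inj. Qed.

End ContractUnicyclization.

End ContractedCycles.

Theorem proposition4p4p2 (G : graph) (k : nat) (A : unicyclization G k)
    (b : zbasis (Z1 G) k.+1) (s : edge G) (hs : src s != tgt s) :
  exists (Ac : unicyclization (contract hs) k)
         (bc : zbasis (Z1 (contract hs)) k.+1),
    forall C : Z1 G, exists Cc : Z1 (contract hs),
      chain_of_Z1 Cc = delete_entry hs (chain_of_Z1 C)
      /\ zcoord b C = zcoord bc Cc
      /\ winding A b C = winding Ac bc Cc.
Proof.
exists (contract_unicyclization hs A).
exists (map_zbasis (contract_cycleK hs) (@lift_cycleK G s hs) b).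
move=> C; exists (contract_cycle hs C); split; first by [].
have coordE := zcoord_map_zbasis (contract_cycleK hs) (@lift_cycleK G s hs) b.
split; first by rewrite coordE.
(* The first columns now agree; the others do because each new column is the image of an old one
   under [contract_cycle]. *)
rewrite /winding coordE; congr (\det (row_mx _ _)).
by apply/matrixP => i j; rewrite !mxE ucycle_contract coordE.
Qed.
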